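(* Let $G=(U,W,T,S)$ be an $S_{\mathcal{MC}}$-approximation, and let $$\tau=\{\overline{G}(A)\mid A\subseteq W\}.$$ Then $(U,\tau)$ is a topology, i.e. $\tau$ is a family of subsets of $U$ that contains $\emptyset$ and $U$ and is closed under arbitrary unions and finite intersections.
   Context: For a finite set $W$, $P(W)$ denotes the set of all subsets of $W$ and $P^{\star}(W)$ the set of all non-empty subsets of $W$; $X^c=W\setminus X$ for $X\subseteq W$. An $S_{\mathcal{MC}}$-approximation is a quadruple $G=(U,W,T,S)$ where $U$ and $W$ are finite non-empty sets, $T:U\to P^{\star}(W)$ and $S:P(W)\times P(W)\to\{0,1\}$ are maps such that: (i) ($S$-min condition) $S(A,B\cap C)=\min\{S(A,B),S(A,C)\}$ for all non-empty $A,B,C\subseteq W$; (ii) (complement condition) $S(A,B^c)=1-S(A,B)$ for all $A,B\subseteq W$; (iii) $S(A,\emptyset)=0$ for all $A\subseteq W$. For $X\subseteq W$, the upper approximation of $X$ is $\overline{G}(X)=\{x\in U\mid S(T(x),X^c)=0\}$. *)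

(* Defs.v *)
From mathcomp Require Import all_boot.
Set Implicit Arguments.
Unset Strict Implicit.
Unset Printing Implicit Defensive.

(* The value set {0,1} is bool, and values of S are compared in nat through
   the coercion bool >-> nat (so 1 - S A B involves no truncation). *)
Record SMC_approximation := SMCApproximation {
  SMC_U : finType;
  SMC_W : finType;
  SMC_T : SMC_U -> {set SMC_W};
  SMC_S : {set SMC_W} -> {set SMC_W} -> bool;
  SMC_U_nonempty : 0 < #|SMC_U|;
  SMC_W_nonempty : 0 < #|SMC_W|;
  SMC_T_nonempty : forall x : SMC_U, SMC_T x != set0;
  SMC_min : forall A B C : {set SMC_W},
    A != set0 -> B != set0 -> C != set0 ->
    SMC_S A (B :&: C) = minn (SMC_S A B) (SMC_S A C) :> nat;
  SMC_compl : forall A B : {set SMC_W},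
    SMC_S A (~: B) = 1 - SMC_S A B :> nat;
  SMC_empty : forall A : {set SMC_W}, SMC_S A set0 = 0 :> nat
}.

Definition upper_approx (G : SMC_approximation) (X : {set SMC_W G}) :
    {set SMC_U G} :=
  [set x : SMC_U G | SMC_S (SMC_T x) (~: X) == 0 :> nat].

(* As U is finite, a subfamily of tau is an arbitrary element of
   {set {set U}}, and every such subfamily is finite; the intersection of the
   empty subfamily is U. *)
Definition is_topology (U : finType) (tau : {set {set U}}) : Prop :=
  [/\ set0 \in tau,
      [set: U] \in tau,
      forall F : {set {set U}}, F \subset tau -> \bigcup_(A in F) A \in tau
    & forall F : {set {set U}}, F \subset tau -> \bigcap_(A in F) A \in tau].

(* Main.v *)
Require Import Defs.
From mathcomp Require Import all_boot.

(** For a fixed non-empty [A], the map [SMC_S A] is a homomorphism of Boolean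
    algebras from the subsets of [W] to the booleans: it preserves complements
    and binary intersections, and it sends [set0] to [false]. In other words,
    the sets [B] with [SMC_S A B] form an ultrafilter on [W].

    By the complement condition, [x] belongs to [upper_approx X] exactly when
    [SMC_S (SMC_T x) X] holds, so [upper_approx] is itself a homomorphism of
    Boolean algebras, from the subsets of [W] to those of [U]. Its image is
    therefore closed under union and intersection and contains [set0] and
    [[set: U]]; since [U] is finite, every union or intersection of members of
    the image is an iterated binary one. *)

Section UpperApproximation.

Variable G : SMC_approximation.
Implicit Types A B C X Y : {set SMC_W G}.

Lemma SMC_S_set0 A : SMC_S A set0 = false.
Proof. by have := SMC_empty A; case: (SMC_S A set0). Qed.

Lemma SMC_S_setC A B : SMC_S A (~: B) = ~~ SMC_S A B.
Proof. by have := SMC_compl A B; case: (SMC_S A (~: B)); case: (SMC_S A B). Qed.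

(** The min condition is only assumed for non-empty [B] and [C]; it extends to
    empty ones because both sides are then [false]. *)
Lemma SMC_S_setI A B C :
  A != set0 -> SMC_S A (B :&: C) = SMC_S A B && SMC_S A C.
Proof.
move=> A0; have [->|B0] := eqVneq B set0; first by rewrite set0I SMC_S_set0.
have [->|C0] := eqVneq C set0; first by rewrite setI0 SMC_S_set0 andbF.
have := SMC_min A0 B0 C0.
by case: (SMC_S A (B :&: C)); case: (SMC_S A B); case: (SMC_S A C).
Qed.

Lemma in_upper_approx X x : (x \in upper_approx X) = SMC_S (SMC_T x) X.
Proof. by rewrite inE SMC_S_setC eqb0 negbK. Qed.

Lemma upper_approx0 : upper_approx (set0 : {set SMC_W G}) = set0.
Proof. by apply/setP=> x; rewrite in_upper_approx SMC_S_set0 inE. Qed.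

Lemma upper_approxC X : upper_approx (~: X) = ~: upper_approx X.
Proof.
by apply/setP=> x; rewrite in_setC !in_upper_approx SMC_S_setC.
Qed.

Lemma upper_approxT : upper_approx [set: SMC_W G] = [set: SMC_U G].
Proof. by rewrite -setC0 upper_approxC upper_approx0 setC0. Qed.

Lemma upper_approxI X Y :
  upper_approx (X :&: Y) = upper_approx X :&: upper_approx Y.
Proof.
apply/setP=> x.
by rewrite in_setI !in_upper_approx SMC_S_setI // SMC_T_nonempty.
Qed.

Lemma upper_approxU X Y :
  upper_approx (X :|: Y) = upper_approx X :|: upper_approx Y.
Proof.
by apply: setC_inj; rewrite setCU -!upper_approxC setCU upper_approxI.
Qed.

End UpperApproximation.

Theorem theorem3p2 (G : SMC_approximation) :
  is_topology [set upper_approx A | A : {set SMC_W G}].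
Proof.
set tau := [set _ | _ : _].
have tau0 : set0 \in tau by rewrite -(upper_approx0 G) imset_f.
have tauT : [set: SMC_U G] \in tau by rewrite -upper_approxT imset_f.
split=> // F /subsetP Ftau.
- apply: (big_ind (fun B => B \in tau)) => // _ _ /imsetP[X _ ->] /imsetP[Y _ ->].
  by rewrite -upper_approxU imset_f.
- apply: (big_ind (fun B => B \in tau)) => // _ _ /imsetP[X _ ->] /imsetP[Y _ ->].
  by rewrite -upper_approxI imset_f.
Qed.
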